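(* For any abelian group $A$ and any function $\tau:\mathbb{Z}_3\to A$ with $\tau(0)=0$, the Galkin quandle $G(A,\tau)$ is connected.
   Context: $\mathbb{Z}_n$ denotes the integers modulo $n$. A quandle is a non-empty set $X$ with a binary operation $*$ such that: (1) $a*a=a$ for all $a\in X$; (2) for all $b,c\in X$ there is a unique $a\in X$ with $a*b=c$; (3) $(a*b)*c=(a*c)*(b*c)$ for all $a,b,c\in X$. For an abelian group $A$ and a function $\tau:\mathbb{Z}_3\to A$ with $\tau(0)=0$, the Galkin quandle $G(A,\tau)$ is the set $\mathbb{Z}_3\times A$ with operation $(x,a)*(y,b)=(2y-x,\,-a+\mu(x-y)b+\tau(x-y))$, where $\mu:\mathbb{Z}_3\to\mathbb{Z}$ is given by $\mu(0)=2$, $\mu(1)=\mu(2)=-1$. For $a$ in a quandle $X$, the right translation $\mathcal{R}_a:X\to X$, $\mathcal{R}_a(x)=x*a$, is a permutation of $X$; the inner automorphism group $\mathrm{Inn}(X)$ is the subgroup of $\mathrm{Sym}(X)$ generated by all $\mathcal{R}_a$, $a\in X$. A quandle $X$ is connected if $\mathrm{Inn}(X)$ acts transitively on $X$. *)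

(* Defs.v *)
From HB Require Import structures.
From mathcomp Require Import all_boot all_order all_algebra.
From mathcomp Require Import boolp classical_sets.

Set Implicit Arguments.
Unset Strict Implicit.
Unset Printing Implicit Defensive.

Import GRing.Theory.
Local Open Scope classical_set_scope.
Local Open Scope ring_scope.

Record quandle := Quandle {
  quandle_sort :> Type;
  qop : quandle_sort -> quandle_sort -> quandle_sort;
  quandle_nonempty : inhabited quandle_sort;
  qop_idem : forall a, qop a a = a;
  qop_div : forall b c, exists! a, qop a b = c;
  qop_dist : forall a b c, qop (qop a b) c = qop (qop a c) (qop b c)
}.

(* Symmetric group of an arbitrary, possibly infinite, type ({perm T} needs a
   finType); as for {perm T}, the product s * t applies s first. *)
Record sym (X : Type) := Sym {
  sym_fun :> X -> X;
  sym_bij : bijective sym_fun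
}.

HB.instance Definition _ (X : Type) := gen_eqMixin (sym X).
HB.instance Definition _ (X : Type) := gen_choiceMixin (sym X).

Section SymGroup.
Variable X : Type.
Implicit Types s t u : sym X.

Lemma symP s t : s =1 t -> s = t.
Proof.
case: s t => [f bf] [g bg] /= /funext efg.
by case: _ / efg bg => bg; congr Sym; exact: Prop_irrelevance.
Qed.

Definition sym1 : sym X := Sym (Bijective (frefl id) (frefl id)).

Definition symM s t : sym X := Sym (bij_comp (sym_bij t) (sym_bij s)).

Lemma sym_inv_exists s : exists g : X -> X, cancel s g /\ cancel g s.
Proof. by case: s => f [g fK gK]; exists g. Qed.

Definition sym_inv_fun s : X -> X := projT1 (cid (sym_inv_exists s)).

Lemma symK s : cancel s (sym_inv_fun s).
Proof. by rewrite /sym_inv_fun; case: cid => g []. Qed.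

Lemma symKV s : cancel (sym_inv_fun s) s.
Proof. by rewrite /sym_inv_fun; case: cid => g []. Qed.

Definition symV s : sym X := Sym (Bijective (symKV s) (symK s)).

Lemma symMA : associative symM.
Proof. by move=> s t u; apply: symP. Qed.

Lemma sym1M : left_id sym1 symM.
Proof. by move=> s; apply: symP. Qed.

Lemma symM1 : right_id sym1 symM.
Proof. by move=> s; apply: symP. Qed.

Lemma symVM : left_inverse sym1 symV symM.
Proof. by move=> s; apply: symP => x; rewrite /= symKV. Qed.

Lemma symMV : right_inverse sym1 symV symM.
Proof. by move=> s; apply: symP => x; rewrite /= symK. Qed.

End SymGroup.

HB.instance Definition _ (X : Type) :=
  isGroup.Build (sym X) (@symMA X) (@sym1M X) (@symM1 X) (@symVM X) (@symMV X).

Section Inner.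
Variable X : quandle.

Lemma qop_bij (a : X) : bijective (fun x => qop x a).
Proof.
pose g c := projT1 (cid (qop_div a c)).
have gP c : qop (g c) a = c by rewrite /g; case: cid => d [].
exists g => // x; rewrite {1}/g; case: cid => d /= [_]; exact.
Qed.

Definition rtrans (a : X) : sym X := Sym (qop_bij a).

Definition Inn : set (sym X) :=
  smallest (fun H : set (sym X) => group_closed [in H]) (range rtrans).

Definition quandle_connected : Prop := forall x y : X, exists2 s, Inn s & s x = y.

End Inner.

Definition mu (i : 'Z_3) : int := if i == 0 then 2 else -1.

Section Galkin.
Variables (A : zmodType) (tau : 'Z_3 -> A).
Implicit Types p q r : 'Z_3 * A.

Definition galkin_op p q : 'Z_3 * A :=
  (2 * q.1 - p.1, - p.2 + q.2 *~ mu (p.1 - q.1) + tau (p.1 - q.1)).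

Lemma galkin_div q r : exists! p, galkin_op p q = r.
Proof.
case: q r => [y b] [z c].
exists (2 * y - z,
  - c + b *~ mu (2 * y - z - y) + tau (2 * y - z - y)); split.
  rewrite /galkin_op /= subKr; congr (_, _).
  by rewrite -!addrA opprD opprK subrK.
case=> x a [<- <-]; rewrite subKr; congr (_, _).
by rewrite -!addrA opprD opprK subrK.
Qed.

Hypothesis tau0 : tau 0 = 0.

Lemma galkin_idem p : galkin_op p p = p.
Proof.
case: p => x a; rewrite /galkin_op /= subrr tau0 addr0 /mu eqxx.
by rewrite mulr_natl mulr2n addrK -pmulrn mulr2n addKr.
Qed.

Local Ltac zcancel1 v w :=
  first [rewrite (addKr v) | rewrite (addNKr v)
        | rewrite (addrCA _ w); zcancel1 v w].

Local Ltac zcancel :=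
  match goal with
  | |- - ?v + _ = 0 => zcancel1 v v
  | |- ?v + _ = 0 => zcancel1 v (- v)
  end.

Lemma galkin_dist p q r :
  galkin_op (galkin_op p q) r = galkin_op (galkin_op p r) (galkin_op q r).
Proof.
have Z3P (i : 'Z_3) : [\/ i = 0, i = 1 | i = -1].
  by case: i => [[|[|[|]]]] // ?; [apply: Or31 | apply: Or32 | apply: Or33];
     apply/val_inj.
have E2 : 2 = -1 :> 'Z_3 by apply/val_inj.
have D1 : 1 + 1 = -1 :> 'Z_3 by apply/val_inj.
have D2 : -1 - 1 = 1 :> 'Z_3 by apply/val_inj.
case: p q r => [x a] [y b] [z c]; rewrite /galkin_op /= E2 !mulN1r.
congr (_, _); first by case: (Z3P x) => ->; case: (Z3P y) => ->;
  case: (Z3P z) => ->; apply/val_inj.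
apply/eqP; rewrite -subr_eq0; apply/eqP.
case: (Z3P x) => ->; case: (Z3P y) => ->; case: (Z3P z) => ->;
rewrite ?(oppr0, addr0, add0r, opprK, subrr, addNr, D1, D2) /mu /=.
all: rewrite ?(tau0, mulrNz, mulr1z, mulr2z).
all: rewrite -?pmulrn ?mulr2n.
all: rewrite ?(opprD, opprK, oppr0) -?addrA ?(add0r, addr0).
all: rewrite -[LHS]addr0 -?addrA; do ?zcancel; reflexivity.
Qed.

Definition galkin : quandle :=
  Quandle (inhabits (0, 0)) galkin_idem galkin_div galkin_dist.

End Galkin.

(* Main.v *)
Require Import Defs.
From mathcomp Require Import all_boot all_order all_algebra.
From mathcomp Require Import classical_sets.
Import GRing.Theory.
Local Open Scope ring_scope.

(** Right translation by [(y, b)] sends the fibre over [x] to the fibre over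
    [2 * y - x].  For [y != x] the multiplier [mu (x - y)] is [-1], so as [b]
    runs over [A] the image of a given [(x, a)] runs over that whole fibre.
    Since [2 = -1] in Z/3, the element [y = - (x + z)] leads from [x] to [z], and
    it differs from [x] exactly when [z] does.  Hence a single right
    translation joins any two points in different fibres
    ([galkin_reach_fibre]), and two points in the same fibre are joined by
    passing through another fibre. *)

Lemma Inn_rtrans (X : quandle) (a : X) : Inn (rtrans a).
Proof. by move=> H [_]; apply; exists a. Qed.

Lemma Inn_mul (X : quandle) (s t : sym X) :
  Inn s -> Inn t -> Inn (symM s t).
Proof.
move=> Is It H HP; case: (HP) => Hgrp _.
have /(_ s t) := group_closedM Hgrp.
by rewrite !inE; apply; [exact: Is | exact: It].
Qed.

(** One translation suffices between distinct fibres because the multiplier of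
    [b] there is the unit [-1], so that the equation for [b] is solvable in any
    abelian group; within a fibre [b] appears with multiplier [2] and the
    equation can fail. *)
Lemma galkin_reach_fibre {A : zmodType} (tau : 'Z_3 -> A) (x z : 'Z_3)
    (a c : A) :
  x != z -> exists q, galkin_op tau (x, a) q = (z, c).
Proof.
move=> xz.
(* The second coordinate solves - a - b + tau (x - y) = c for b. *)
exists (- (x + z), tau (x - - (x + z)) - a - c).
rewrite /galkin_op /=.
have -> : mu (x - - (x + z)) = -1.
  by move: x z xz; do 2![case=> [[|[|[|]]]] //= ?].
rewrite mulrNz mulr1z; congr (_, _).
  have -> : 2 = -1 :> 'Z_3 by apply/val_inj.
  by rewrite mulN1r opprK addrC addKr.
by rewrite -opprD addrC -(addrA (tau _)) addrCA addNKr subKr.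
Qed.

Theorem lemma4p4 (A : zmodType) (tau : 'Z_3 -> A) (tau0 : tau 0 = 0) :
  quandle_connected (galkin tau0).
Proof.
case=> [x a] [z c].
have [<-{z} | xz] := eqVneq x z; last first.
  have [q qE] := galkin_reach_fibre tau x z a c xz.
  by exists (@rtrans (galkin tau0) q); [exact: Inn_rtrans | exact: qE].
(* Same fibre: detour through the point (x + 1, 0). *)
have xw : x != x + 1 by rewrite eq_sym -subr_eq0 addrC addKr.
have [q qE] := galkin_reach_fibre tau x (x + 1) a 0 xw.
rewrite eq_sym in xw.
have [r rE] := galkin_reach_fibre tau (x + 1) x 0 c xw.
exists (symM (@rtrans (galkin tau0) q) (@rtrans (galkin tau0) r)).
  by apply: Inn_mul; exact: Inn_rtrans.
by rewrite /= qE rE.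
Qed.
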